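(* Let $G$ be a countable amenable group. Let $(X,\mathcal{B},\mu,(T_g)_{g\in G})$ be an ergodic measure preserving system. Let $A\in\mathcal{B}$ with $\mu(A)>0$ and let $(F_N)$ be a F\o lner sequence in $G$. Then there exist a subsequence $(F_{N_k})$ of $(F_N)$ and a set $E\subseteq G$ such that $$\mu((T_{g_1})^{-1}A\cap\dots\cap(T_{g_r})^{-1}A)=d_{(F_{N_k})}(g_1^{-1}E\cap\dots\cap g_r^{-1}E)$$ for all $r\in\mathbb{N}$ and $g_1,\dots,g_r\in G$ (in particular, $\mu(A)=d_{(F_{N_k})}(E)$).
   Context: A (left) F\o lner sequence in a countable group $G$ is a sequence $(F_N)$ of finite non-empty subsets of $G$ with $\lim_{N\to\infty}|F_N\,\Delta\, gF_N|/|F_N|=0$ for all $g\in G$; $G$ is amenable if it admits one. For $C\subseteq G$, $d_{(F_{N_k})}(C)=\lim_{k\to\infty}\frac{|C\cap F_{N_k}|}{|F_{N_k}|}$ (existence of the limit being part of the assertion). $g^{-1}E=\{h\in G: gh\in E\}$. A measure preserving system is a probability space $(X,\mathcal{B},\mu)$ with a measure preserving action $(T_g)_{g\in G}$ of $G$ ($T_gT_h=T_{gh}$). *)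

(* Defs.v *)
From mathcomp Require Import all_boot all_order all_algebra.
From mathcomp Require Import finmap.
From mathcomp Require Import all_classical all_reals all_analysis.

Set Implicit Arguments.
Unset Strict Implicit.
Unset Printing Implicit Defensive.

Import Order.TTheory GRing.Theory Num.Theory.
Import numFieldNormedType.Exports.

Local Open Scope classical_set_scope.
Local Open Scope ring_scope.

Definition ltranslate (G : groupType) (g : G) (F : {fset G}) : {fset G} :=
  [fset (g * h)%g | h in F]%fset.

Definition fsymdiff (K : choiceType) (A B : {fset K}) : {fset K} :=
  ((A `\` B) `|` (B `\` A))%fset.

(* The ratios below lie in R only because mathcomp-analysis has no fixed type
   of real numbers. *)
Definition left_Folner (R : realType) (G : groupType) (F : nat -> {fset G}) :
    Prop :=
  (forall N, F N != fset0) /\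
  (forall g : G,
    (fun N => #|` fsymdiff (F N) (ltranslate g (F N)) |%:R / #|` F N |%:R : R)
      @ \oo --> (0 : R)).

Definition amenable (R : realType) (G : groupType) : Prop :=
  exists F : nat -> {fset G}, left_Folner R F.

(* The density of C along F exists and equals a. *)
Definition has_density (R : realType) (G : groupType) (F : nat -> {fset G})
    (C : set G) (a : R) : Prop :=
  (fun k => #|` [fset h in F k | h \in C]%fset |%:R / #|` F k |%:R : R)
    @ \oo --> a.

(* g^{-1} E *)
Definition inv_translate (G : groupType) (g : G) (E : set G) : set G :=
  [set h | E (g * h)%g].

Record mp_action (R : realType) (d : measure_display) (X : measurableType d)
    (mu : probability X R) (G : groupType) (T : G -> X -> X) : Prop := {
  mp_action1 : forall x, T 1%g x = x ;
  mp_actionM : forall g h x, T g (T h x) = T (g * h)%g x ;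
  mp_measurable : forall g, measurable_fun [set: X] (T g) ;
  mp_preserving : forall g B, measurable B -> mu (T g @^-1` B) = mu B }.

Definition ergodic (R : realType) (d : measure_display) (X : measurableType d)
    (mu : probability X R) (G : groupType) (T : G -> X -> X) : Prop :=
  forall B : set X, measurable B -> (forall g, T g @^-1` B = B) ->
    mu B = 0%E \/ mu B = 1%E.

(* Main.v *)
Require Import Defs.
From mathcomp Require Import all_boot all_order all_algebra.
From mathcomp Require Import finmap.
From mathcomp Require Import all_classical all_reals all_analysis.
From mathcomp Require Import measurable_realfun ring lra.
Import Order.TTheory GRing.Theory Num.Theory.
Import numFieldNormedType.Exports.
Local Open Scope classical_set_scope.
Local Open Scope ring_scope.

Set Implicit Arguments.
Unset Strict Implicit.
Unset Printing Implicit Defensive.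

(** The set [E] is the set of times at which the orbit of a well chosen point [x]
    visits [A]. Since [T g (T h x) = T (g * h) x], an element [h] lies in the
    intersection of the [g_i^-1 E] exactly when [T h x] lies in the intersection
    [B] of the sets [(T g_i)^-1 A]. The density in question is therefore the limit of
    the averages of the indicator of [B] over the points [T h x], [h] in a Folner set
    ([densityE]), and the theorem asks for a point [x] that is generic for the
    countably many sets [B] simultaneously.

    The mean ergodic theorem provides L2 convergence of these averages, and
    a subsequence along which the convergence is fast provides almost everywhere
    convergence. Only Cauchy estimates are proved in L2; the limit function is formed
    pointwise, along the subsequence. Given a bounded measurable [f], consider the bounded measurable functions
    whose Folner averages are uniformly asymptotic to those of [f]
    ([same_averages]). These functions form a convex set that is invariant under the
    action, by the Folner property ([same_averages_translate]), and therefore contains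
    every average of [f]. Late Folner averages of [f] nearly realize the infimum of the
    L2 norm on this set ([avg_energy_le]), and by the parallelogram identity nearly
    minimal elements are close to each other ([near_min_energy_close]). Hence the
    averages of [f] form an L2 Cauchy sequence and are asymptotically invariant
    ([mean_ergodic_cauchy]).

    A diagonal choice of indices makes these estimates geometrically small for all
    the sets [B] ([generic_subseq]). Borel-Cantelli then gives almost everywhere
    convergence to an almost everywhere invariant limit, which ergodicity forces to be
    the constant [mu B] ([almost_invariant_ae_cvg]). Any point outside a countable
    union of null sets can be taken for [x]. *)

(** * Bounded measurable functions and their integrals *)

Section BoundedMeasurable.
Context (R : realType) (d : measure_display) (X : measurableType d).
Implicit Types f g : X -> R.

Definition bdmeas f :=
  measurable_fun [set: X] f /\ exists M, forall x, `|f x| <= M.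

Lemma bdmeas_cst (r : R) : bdmeas (fun=> r).
Proof. by split=> //; exists `|r|. Qed.

Lemma bdmeasD f g : bdmeas f -> bdmeas g -> bdmeas (fun x => f x + g x).
Proof.
move=> [mf [M fM]] [mg [N gN]]; split; first exact: measurable_funD.
by exists (M + N) => x; rewrite (le_trans (ler_normD _ _))// lerD.
Qed.

Lemma bdmeasM f g : bdmeas f -> bdmeas g -> bdmeas (fun x => f x * g x).
Proof.
move=> [mf [M fM]] [mg [N gN]]; split; first exact: measurable_funM.
by exists (M * N) => x; rewrite normrM ler_pM.
Qed.

Lemma bdmeasZ (r : R) f : bdmeas f -> bdmeas (fun x => r * f x).
Proof. by move=> bf; apply: bdmeasM => //; exact: bdmeas_cst. Qed.

Lemma bdmeasB f g : bdmeas f -> bdmeas g -> bdmeas (fun x => f x - g x).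
Proof.
move=> bf /(bdmeasZ (-1)) bg; have := bdmeasD bf bg.
by congr bdmeas; apply/funext => x; rewrite mulN1r.
Qed.

Lemma bdmeasX2 f : bdmeas f -> bdmeas (fun x => f x ^+ 2).
Proof. by move=> bf; exact: bdmeasM. Qed.

Lemma bdmeas_sum (I : Type) (s : seq I) (f : I -> X -> R) :
  (forall i, bdmeas (f i)) -> bdmeas (fun x => \sum_(i <- s) f i x).
Proof.
move=> bf; elim: s => [|i s IHs].
  by under eq_fun do rewrite big_nil; exact: bdmeas_cst.
by under eq_fun do rewrite big_cons; exact: bdmeasD.
Qed.

Lemma bdmeas_comp (t : X -> X) f :
  measurable_fun [set: X] t -> bdmeas f -> bdmeas (f \o t).
Proof.
move=> mt [mf [M fM]]; split; first exact: measurableT_comp.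
by exists M => x /=.
Qed.

Lemma bdmeas_indic (B : set X) : measurable B -> bdmeas (\1_B).
Proof.
move=> mB; split; first exact: measurable_indic.
by exists 1 => x; rewrite indicE; case: (_ \in _); rewrite ?normr1 ?normr0.
Qed.

Context (mu : probability X R).

Lemma bdmeas_integrable f :
  bdmeas f -> mu.-integrable [set: X] (EFin \o f).
Proof.
move=> [mf [M fM]]; apply: measurable_bounded_integrable => //.
  by rewrite [X in (X < _)%E](probability_setT mu) ltry.
exists M; split; first exact: num_real.
by move=> N MN x _ /=; rewrite (le_trans (fM x))// ltW.
Qed.

Lemma integral_bdmeas f :
  bdmeas f -> (\int[mu]_x (f x)%:E)%E = (\int[mu]_x f x)%:E.
Proof.
by move=> /bdmeas_integrable fi; rewrite /Rintegral fineK//; exact: integrable_fin_num.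
Qed.

Lemma expect_cst (r : R) : \int[mu]_x (cst r x) = r.
Proof.
by rewrite Rintegral_cst// [X in fine X](probability_setT mu) mulr1.
Qed.

Lemma expectD f g : bdmeas f -> bdmeas g ->
  \int[mu]_x (f x + g x) = \int[mu]_x f x + \int[mu]_x g x.
Proof. by move=> bf bg; rewrite RintegralD//; exact: bdmeas_integrable. Qed.

Lemma expectB f g : bdmeas f -> bdmeas g ->
  \int[mu]_x (f x - g x) = \int[mu]_x f x - \int[mu]_x g x.
Proof. by move=> bf bg; rewrite RintegralB//; exact: bdmeas_integrable. Qed.

Lemma expectZ (r : R) f : bdmeas f ->
  \int[mu]_x (r * f x) = r * \int[mu]_x f x.
Proof. by move=> bf; rewrite RintegralZl//; exact: bdmeas_integrable. Qed.

Lemma expect_sum (I : Type) (s : seq I) (f : I -> X -> R) :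
  (forall i, bdmeas (f i)) ->
  \int[mu]_x (\sum_(i <- s) f i x) = \sum_(i <- s) \int[mu]_x f i x.
Proof.
move=> bf; elim: s => [|i s IHs].
  rewrite big_nil; under eq_Rintegral do rewrite big_nil.
  exact: (expect_cst 0).
rewrite big_cons -IHs; under eq_Rintegral do rewrite big_cons.
by rewrite expectD//; exact: bdmeas_sum.
Qed.

Lemma le_expect f g : bdmeas f -> bdmeas g -> (forall x, f x <= g x) ->
  \int[mu]_x f x <= \int[mu]_x g x.
Proof. by move=> bf bg fg; apply: le_Rintegral => //; exact: bdmeas_integrable. Qed.

Lemma expect_indic (B : set X) : measurable B ->
  \int[mu]_x (\1_B x) = fine (mu B).
Proof. by move=> mB; rewrite /Rintegral integral_indic// setIT. Qed.

Lemma expect_comp (t : X -> X) f : measurable_fun [set: X] t ->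
  (forall B, measurable B -> mu (t @^-1` B) = mu B) ->
  bdmeas f -> \int[mu]_x f (t x) = \int[mu]_x f x.
Proof.
move=> mt pt bf; rewrite /Rintegral; congr fine.
transitivity (\int[pushforward mu t]_x (f x)%:E)%E.
  rewrite (integral_pushforward mt (D := setT)) ?preimage_setT//.
    by apply/measurable_EFinP; case: bf.
  exact: (bdmeas_integrable (bdmeas_comp mt bf)).
apply: eq_measure_integral => B mB _; exact: pt.
Qed.

(** This is how an almost everywhere inequality with a constant, together with
    the value of the integral, is upgraded to an almost everywhere equality. *)
Lemma expect_ae_eq0 f : mu.-integrable [set: X] (EFin \o f) ->
  (\forall x \ae mu, 0 <= f x) ->
  \int[mu]_x f x = 0 -> \forall x \ae mu, f x = 0.
Proof.
move=> fi f0 If.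
have mf : measurable_fun [set: X] (EFin \o f) by case/integrableP : fi.
have : ae_eq mu [set: X] (EFin \o f) (cst 0%E).
  apply/(ae_eq_integral_abs mu measurableT mf).
  rewrite (ae_eq_integral (EFin \o f))//.
  - by rewrite -[LHS]fineK ?integrable_fin_num// -/(Rintegral _ _ _) If.
  - exact: measurableT_comp.
  - by apply: filterS f0 => x fx _ /=; rewrite ger0_norm.
by apply: filterS => x /(_ Logic.I) /= [].
Qed.

Lemma measurable_gt_norm (h : X -> R) (a : R) :
  measurable_fun [set: X] h -> measurable [set x | a < `|h x|].
Proof.
move=> mh.
have mf : measurable_fun [set: X] (Num.norm \o h) by exact: measurableT_comp.
have := measurable_fun_ltr (measurable_cst a) mf.
by move=> /(_ measurableT [set true]); rewrite setTI; apply.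
Qed.

Lemma chebyshev_bdmeas f (a : R) : bdmeas f -> 0 < a ->
  (mu [set x | (a < `|f x|)%R] <= ((\int[mu]_x (f x ^+ 2)) / a ^+ 2)%:E)%E.
Proof.
move=> bf a0.
have mB : measurable [set x | a < `|f x|].
  by apply: measurable_gt_norm; case: bf.
rewrite -[X in (X <= _)%E](@fineK _ (mu _)) ?fin_num_measure//.
rewrite lee_fin -expect_indic// ler_pdivlMr ?exprn_gt0// mulrC -expectZ; last first.
  exact: bdmeas_indic.
apply: le_expect => [||x]; [exact/bdmeasZ/bdmeas_indic|exact: bdmeasX2|].
rewrite indicE; case: (boolP (_ \in _)) => [|_]; last by rewrite mulr0 sqr_ge0.
rewrite inE /= => /ltW ax; rewrite mulr1 -(real_normK (num_real (f x))).
by rewrite lerXn2r// nnegrE// ltW.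
Qed.

End BoundedMeasurable.

(** * Averages over finite subsets of the group *)

Section Averages.
Context (R : realType) (G : groupType) (X : Type) (T : G -> X -> X).
Implicit Types (S : {fset G}) (f : X -> R).

Definition avg S f (x : X) : R := (\sum_(h <- S) f (T h x)) / #|` S|%:R.

Lemma card_gt0R S : S != fset0 -> 0 < #|` S|%:R :> R.
Proof. by move=> S0; rewrite ltr0n cardfs_gt0. Qed.

Lemma avgB S f g x : avg S (fun y => f y - g y) x = avg S f x - avg S g x.
Proof. by rewrite /avg sumrB mulrBl. Qed.

Lemma avgD S f g x : avg S (fun y => f y + g y) x = avg S f x + avg S g x.
Proof. by rewrite /avg big_split mulrDl. Qed.

Lemma avgZ S (r : R) f x : avg S (fun y => r * f y) x = r * avg S f x.
Proof. by rewrite /avg -mulr_sumr mulrA. Qed.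

Lemma avg_cst S (r : R) x : S != fset0 -> avg S (fun=> r) x = r.
Proof.
move=> /card_gt0R S0; rewrite /avg big_const_seq count_predT iter_addr.
by rewrite addr0 -[r *+ _]mulr_natr mulfK// gt_eqF.
Qed.

Lemma le_avg S f g x : (forall y, f y <= g y) -> avg S f x <= avg S g x.
Proof. by move=> fg; rewrite ler_wpM2r ?invr_ge0//; exact: ler_sum. Qed.

Lemma norm_avg_le S f (M : R) x : S != fset0 ->
  (forall y, `|f y| <= M) -> `|avg S f x| <= M.
Proof.
move=> S0 fM; have fM' y : - M <= f y <= M by rewrite -ler_norml.
rewrite ler_norml -{1}(avg_cst (- M) x S0) -[X in _ && (_ <= X)](avg_cst M x S0).
by rewrite !le_avg// => y; have /andP[] := fM' y.
Qed.

(** Jensen's inequality for the uniform measure on [S]: the average of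
    [(f - avg f)^2] is nonnegative. *)
Lemma sqr_avg_le S f x : S != fset0 ->
  avg S f x ^+ 2 <= avg S (fun y => f y ^+ 2) x.
Proof.
move=> S0; set c := avg S f x.
have : 0 <= avg S (fun y => (f y - c) ^+ 2) x.
  by rewrite -[leLHS](avg_cst 0 x S0) le_avg// => y; exact: sqr_ge0.
have -> : (fun y => (f y - c) ^+ 2) =
    (fun y => (f y ^+ 2 - (2 * c) * f y) + c ^+ 2).
  by apply/funext => y; ring.
rewrite avgD avg_cst// (avgB S (fun y => f y ^+ 2)) avgZ -/c.
lra.
Qed.

Hypothesis TM : forall g h x, T g (T h x) = T (g * h)%g x.

(** The sums of [f] over [g S x] and over [S x] agree except for the terms
    indexed by the symmetric difference of [S] and [g S]. The translation acts on
    the left of [S], which is why left Folner sequences are the relevant ones. *)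
Lemma avg_translate S f (g : G) (M : R) x : (forall y, `|f y| <= M) ->
  `|avg S (f \o T g) x - avg S f x| <=
    M * (#|` fsymdiff S (ltranslate g S)|%:R / #|` S|%:R).
Proof.
move=> fM; rewrite /avg -mulrBl normrM mulrA.
rewrite [X in _ * X]ger0_norm ?invr_ge0// ler_wpM2r ?invr_ge0//.
have -> : \sum_(h <- S) (f \o T g) (T h x) = \sum_(k <- ltranslate g S) f (T k x).
  rewrite big_imfset/=; last by move=> a b _ _; exact: mulgI.
  by apply: eq_bigr => h _; rewrite TM.
set S' := ltranslate g S.
have sumID (A B : {fset G}) : \sum_(h <- A) f (T h x) =
    \sum_(h <- (A `&` B)%fset) f (T h x) + \sum_(h <- (A `\` B)%fset) f (T h x).
  rewrite (big_fsetID _ (mem B) A)/=; congr (_ + _); apply: eq_fbigl => h.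
    by rewrite !inE.
  by rewrite !inE andbC.
have card_sum (A : {fset G}) : `|\sum_(h <- A) f (T h x)| <= M * #|` A|%:R.
  rewrite (le_trans (ler_norm_sum _ _ _))//.
  rewrite (le_trans (ler_sum _ (fun h _ => fM (T h x))))//.
  by rewrite big_const_seq count_predT iter_addr addr0 mulr_natr.
rewrite (sumID S' S) (sumID S S') fsetIC opprD addrACA subrr add0r.
rewrite (le_trans (ler_normB _ _))// (le_trans (lerD (card_sum _) (card_sum _)))//.
rewrite -mulrDr -natrD addnC -cardfsUI.
rewrite (_ : ((S `\` S') `&` (S' `\` S))%fset = fset0) ?cardfs0 ?addn0//.
by apply/fsetP => h; rewrite !inE; case: (h \in S); case: (h \in S').
Qed.

End Averages.

(** * The mean ergodic theorem in Cauchy form *)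

Section MeanErgodic.
Context (R : realType) (G : groupType) (d : measure_display)
  (X : measurableType d) (mu : probability X R) (T : G -> X -> X)
  (T_mp : mp_action mu T) (F : nat -> {fset G}) (F_Folner : left_Folner R F).
Implicit Types f phi psi : X -> R.

Let F0 N : F N != fset0. Proof. by case: F_Folner. Qed.
Let TM g h x : T g (T h x) = T (g * h)%g x. Proof. by case: T_mp. Qed.
Let mT g : measurable_fun [set: X] (T g). Proof. by case: T_mp. Qed.

Lemma bdmeas_translate f (g : G) : bdmeas f -> bdmeas (f \o T g).
Proof. exact: bdmeas_comp. Qed.

Lemma bdmeas_avg (S : {fset G}) f : bdmeas f -> bdmeas (avg T S f).
Proof.
move=> bf; rewrite /avg; under eq_fun do rewrite mulrC.
by apply: bdmeasZ; apply: bdmeas_sum => h; exact: bdmeas_translate.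
Qed.

Lemma expect_translate f (g : G) : bdmeas f ->
  \int[mu]_x f (T g x) = \int[mu]_x f x.
Proof. by move=> bf; apply: expect_comp => // B; exact: mp_preserving. Qed.

Lemma expect_avg (S : {fset G}) f : S != fset0 -> bdmeas f ->
  \int[mu]_x avg T S f x = \int[mu]_x f x.
Proof.
move=> S0 bf; rewrite /avg; under eq_Rintegral do rewrite mulrC.
rewrite expectZ; last by apply: bdmeas_sum => h; exact: bdmeas_translate.
rewrite expect_sum; last by move=> h; exact: bdmeas_translate.
under eq_bigr do rewrite expect_translate//.
rewrite big_const_seq count_predT iter_addr addr0 -[X in _ * X]mulr_natr.
by rewrite mulrCA mulVf ?mulr1// gt_eqF// card_gt0R.
Qed.

(** This set replaces the closed convex hull of the orbit of [f]: it is convex,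
    invariant under the action and contains [f], which is all that the
    minimal-norm argument uses. *)
Definition same_averages f : set (X -> R) :=
  [set phi | bdmeas phi /\ forall e, 0 < e -> \forall N \near \oo,
     forall x, `|avg T (F N) phi x - avg T (F N) f x| <= e].

Lemma same_averages_refl f : bdmeas f -> same_averages f f.
Proof.
move=> bf; split=> // e e0; apply: nearW => N x.
by rewrite subrr normr0 ltW.
Qed.

Lemma same_averages_translate f phi (g : G) :
  same_averages f phi -> same_averages f (phi \o T g).
Proof.
move=> [bphi fphi]; split=> [|e e0]; first exact: bdmeas_translate.
have [_ [M phiM]] := bphi.
have M0 : 0 <= M by rewrite (le_trans _ (phiM point)).
have e2 : 0 < e / 2 by rewrite divr_gt0.
have [_ /(_ g) Fg] := F_Folner.
have /cvgr0Pnorm_le/(_ (e / 2 / (M + 1))) Fg0 := Fg.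
near=> N => x.
rewrite (_ : _ - _ = (avg T (F N) (phi \o T g) x - avg T (F N) phi x) +
   (avg T (F N) phi x - avg T (F N) f x)); last by ring.
rewrite (le_trans (ler_normD _ _))// (splitr e) lerD//.
- apply: (le_trans (avg_translate TM _ _ _ phiM)).
  have /ler_normlW : `|#|` fsymdiff (F N) (ltranslate g (F N)) |%:R / #|` F N |%:R|
    <= e / 2 / (M + 1).
    near: N; apply: Fg0; rewrite divr_gt0//; lra.
  move=> /(ler_wpM2l M0) /le_trans; apply.
  rewrite [X in X <= _](_ : _ = e / 2 * (M / (M + 1))); last by field; lra.
  by apply: ler_piMr; [exact: ltW|rewrite ler_pdivrMr; lra].
- by move: x; near: N; exact: fphi.
Unshelve. all: by end_near. Qed.

Lemma avg_avg (S S' : {fset G}) phi x :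
  avg T S (avg T S' phi) x =
  (\sum_(g <- S') avg T S (phi \o T g) x) / #|` S'|%:R.
Proof.
rewrite /avg -!mulr_suml mulrAC; congr (_ / _ / _).
by rewrite exchange_big.
Qed.

(** [avg T (F N) (avg T S phi)] is the mean over [g] in [S] of the averages of
    [phi \o T g], each of which is eventually uniformly close to that of [f].
    The bound for the sum is proved by induction along the list of elements
    of [S]. *)
Lemma same_averages_avg f phi (S : {fset G}) : S != fset0 ->
  same_averages f phi -> same_averages f (avg T S phi).
Proof.
move=> S0 Kphi; split=> [|e e0]; first by apply: bdmeas_avg; case: Kphi.
have H (s : seq G) : \forall N \near \oo, forall x,
    `|\sum_(g <- s) (avg T (F N) (phi \o T g) x - avg T (F N) f x)|
      <= e * (size s)%:R.
  elim: s => [|g s IHs].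
    by apply: nearW => N x; rewrite big_nil normr0 mulr0.
  have [_ /(_ e e0)] := same_averages_translate g Kphi.
  apply: filterS2 IHs => N IHs gN x.
  rewrite big_cons (le_trans (ler_normD _ _))//= -(addn1 (size s)) natrD.
  by rewrite mulrDr addrC lerD// mulr1.
apply: filterS (H S) => N HN x; rewrite avg_avg.
have S0' : 0 < #|` S|%:R :> R by exact: card_gt0R.
have -> : avg T (F N) f x = (\sum_(g <- S) avg T (F N) f x) / #|` S|%:R.
  rewrite big_const_seq count_predT iter_addr addr0 -[_ *+ size _]mulr_natr.
  by rewrite mulfK// gt_eqF.
rewrite -mulrBl -sumrB normrM [X in _ * X]ger0_norm ?invr_ge0//.
by rewrite ler_pdivrMr.
Qed.

Lemma same_averages_mid f phi psi : same_averages f phi -> same_averages f psi ->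
  same_averages f (fun x => 2^-1 * (phi x + psi x)).
Proof.
move=> [bphi fphi] [bpsi fpsi]; split=> [|e e0]; first exact/bdmeasZ/bdmeasD.
apply: filterS2 (fphi e e0) (fpsi e e0) => N Hphi Hpsi x.
rewrite avgZ avgD; move: (Hphi x) (Hpsi x); rewrite !ler_norml; lra.
Qed.

(** Squared L2 norm. *)
Definition energy phi := \int[mu]_x (phi x ^+ 2).

Lemma energy_ge0 phi : 0 <= energy phi.
Proof. by apply: Rintegral_ge0 => x _; exact: sqr_ge0. Qed.

Lemma energy_translate phi (g : G) : bdmeas phi -> energy (phi \o T g) = energy phi.
Proof. by move=> /bdmeasX2 bphi; rewrite /energy -(expect_translate g bphi). Qed.

Lemma energy_avg_le (S : {fset G}) phi : S != fset0 -> bdmeas phi ->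
  energy (avg T S phi) <= energy phi.
Proof.
move=> S0 bphi; have b2 := bdmeasX2 bphi.
rewrite /energy -[leRHS](expect_avg S0 b2); apply: le_expect.
- exact/bdmeasX2/bdmeas_avg.
- exact: bdmeas_avg.
- by move=> x; exact: sqr_avg_le.
Qed.

Definition min_energy f := inf [set energy phi | phi in same_averages f].

Lemma min_energy_le f phi : same_averages f phi -> min_energy f <= energy phi.
Proof.
move=> Kphi; apply: ge_inf; last by exists phi.
by exists 0 => _ [psi _ <-]; exact: energy_ge0.
Qed.

(** Parallelogram identity: the midpoint of [phi] and [psi] stays in the class, so
    its energy is at least the minimum; almost minimal elements are therefore close
    to each other. *)
Lemma near_min_energy_close f phi psi e : same_averages f phi -> same_averages f psi ->
  energy phi <= min_energy f + e -> energy psi <= min_energy f + e ->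
  energy (fun x => phi x - psi x) <= 4 * e.
Proof.
move=> Kphi Kpsi qphi qpsi.
have := min_energy_le (same_averages_mid Kphi Kpsi).
have [[bphi _] [bpsi _]] := (Kphi, Kpsi).
have -> : energy (fun x => phi x - psi x) =
    2 * energy phi + 2 * energy psi - 4 * energy (fun x => 2^-1 * (phi x + psi x)).
  rewrite /energy.
  have b1 := bdmeasX2 bphi; have b2 := bdmeasX2 bpsi.
  have b3 : bdmeas (fun x => (2^-1 * (phi x + psi x)) ^+ 2).
    exact/bdmeasX2/bdmeasZ/bdmeasD.
  rewrite -!expectZ// -expectD; [|exact: bdmeasZ..].
  rewrite -expectB; [|by apply: bdmeasD; exact: bdmeasZ|exact: bdmeasZ].
  by apply: eq_Rintegral => x _; field.
lra.
Qed.

(** Averaging does not increase the energy, so if [phi] is almost minimal then so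
    are its averages; those of [f] are uniformly close to them along the Folner
    sequence. *)
Lemma avg_energy_le f e : bdmeas f -> 0 < e ->
  \forall N \near \oo, energy (avg T (F N) f) <= min_energy f + e.
Proof.
move=> bf e0; have e2 : 0 < e / 2 by rewrite divr_gt0.
have hi : has_inf [set energy phi | phi in same_averages f].
  split; first by exists (energy f), f => //; exact: same_averages_refl.
  by exists 0 => _ [psi _ <-]; exact: energy_ge0.
have [_ [phi Kphi <-] phie] := inf_adherent e2 hi.
have [bphi fphi] := Kphi.
have [[_ [M fM]] [_ [M' phiM]]] := (bf, bphi).
have M0 : 0 <= M by rewrite (le_trans _ (fM point)).
have M'0 : 0 <= M' by rewrite (le_trans _ (phiM point)).
set D := M + M' + 1.
have D0 : 0 < D by rewrite /D; lra.
have d0 : 0 < e / 2 / D by rewrite divr_gt0.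
apply: filterS (fphi _ d0) => N HN.
apply: (@le_trans _ _ (energy phi + e / 2)); last first.
  by rewrite -/(min_energy f) in phie; lra.
rewrite -lerBlDr (le_trans _ (energy_avg_le (F0 N) bphi))// lerBlDr.
rewrite /energy -[X in _ + X](expect_cst mu) -expectD; last 2 first.
- exact/bdmeasX2/bdmeas_avg.
- exact: bdmeas_cst.
apply: le_expect => [||x].
- exact/bdmeasX2/bdmeas_avg.
- by apply: bdmeasD; [exact/bdmeasX2/bdmeas_avg|exact: bdmeas_cst].
(* a^2 - b^2 = (a - b) (a + b), where |a + b| <= D and |a - b| <= e / 2 / D *)
rewrite -lerBlDl subr_sqr /= (le_trans (ler_norm _))// normrM.
rewrite (_ : e / 2 = e / 2 / D * D); last by rewrite divfK// gt_eqF.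
rewrite ler_pM//; first by rewrite distrC.
rewrite (le_trans (ler_normD _ _))// /D ler_wpDr// lerD//.
  exact: norm_avg_le.
exact: norm_avg_le.
Qed.

(** Averages of [f] over late Folner sets, and their translates, all lie in the
    class of [f] and are almost minimal, hence mutually close. The second estimate
    is not a consequence of the Folner property alone: translating the average by
    [g] replaces [F N] by [F N * g], and the sequence is only left Folner. *)
Lemma mean_ergodic_cauchy f e : bdmeas f -> 0 < e ->
  \forall N \near \oo,
    (forall M, (N <= M)%N ->
       \int[mu]_x ((avg T (F M) f x - avg T (F N) f x) ^+ 2) <= e) /\
    (forall g : G,
       \int[mu]_x ((avg T (F N) f (T g x) - avg T (F N) f x) ^+ 2) <= e).
Proof.
move=> bf e0; have e4 : 0 < e / 4 by rewrite divr_gt0.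
have [n _ Hn] := avg_energy_le bf e4; exists n => // N /= nN.
have Kf N' := same_averages_avg (F0 N') (same_averages_refl bf).
have -> : e = 4 * (e / 4) by field.
split=> [M NM|g].
- apply: (near_min_energy_close (Kf M) (Kf N)); last exact: Hn.
  by apply: Hn => /=; exact: leq_trans NM.
- apply: (near_min_energy_close (same_averages_translate g (Kf N)) (Kf N));
    last exact: Hn.
  by rewrite energy_translate; [exact: Hn|exact: bdmeas_avg].
Qed.

End MeanErgodic.

(** * From fast L2 convergence to almost everywhere convergence *)

Lemma fast_cvgn (R : realType) (u : nat -> R) :
  (\forall k \near \oo, `|u k.+1 - u k| <= 2^-1 ^+ k) -> cvgn u.
Proof.
move=> [K _ HK].
pose v k := u (k + K)%N.
suff : cvgn v.
  move=> /cvg_ex[l vl]; apply/cvg_ex; exists l.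
  by rewrite -(cvg_shiftn K).
have sv : cvgn (series (telescope v)).
  apply: normed_cvg.
  apply: (@series_le_cvg _ _ (geometric 1 2^-1)) => [n|n|n|].
  - exact: normr_ge0.
  - by rewrite /geometric /= mul1r exprn_ge0.
  - rewrite /telescope /geometric /= mul1r /v addSn.
    apply: (le_trans (HK _ _)); first exact: leq_addl.
    by rewrite exprD ler_piMr ?exprn_ge0// exprn_ile1//; lra.
  - by apply: is_cvg_geometric_series; rewrite ger0_norm//; lra.
rewrite (_ : v = cst (v 0%N) + series (telescope v)).
  by apply: is_cvgD => //; exact: is_cvg_cst.
by apply/funext => n; rewrite {1}[v n]eq_sum_telescope.
Qed.

Section FastConvergence.
Context (R : realType) (d : measure_display) (X : measurableType d)
  (mu : probability X R).

(** Chebyshev's inequality and Borel-Cantelli: the exceptional set of index [k] has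
    measure at most [8^-k / (2^-k)^2 = 2^-k]. *)
Lemma ae_fast_small (h : nat -> X -> R) : (forall k, bdmeas (h k)) ->
  (forall k, \int[mu]_x (h k x ^+ 2) <= 8^-1 ^+ k) ->
  \forall x \ae mu, \forall k \near \oo, `|h k x| <= 2^-1 ^+ k.
Proof.
move=> bh qh.
pose E k := [set x | 2^-1 ^+ k < `|h k x|].
have mE k : measurable (E k) by apply: measurable_gt_norm; case: (bh k).
have muE k : (mu (E k) <= ((2^-1 : R) ^+ k)%:E)%E.
  have p0 : 0 < (2^-1 : R) ^+ k by rewrite exprn_gt0.
  apply: (le_trans (chebyshev_bdmeas mu (bh k) p0)).
  rewrite lee_fin ler_pdivrMr ?exprn_gt0// (le_trans (qh k))//.
  rewrite -exprM mulnC exprM -exprMn.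
  by rewrite (_ : (8^-1 : R) = 2^-1 * 2^-1 ^+ 2)//; field.
have null : mu (lim_sup_set E) = 0%E.
  apply: lim_sup_set_cvg0 => //.
  apply: (@le_lt_trans _ _ (\sum_(0 <= k <oo) ((2^-1 : R) ^+ k)%:E)%E).
    by apply: lee_nneseries => [k _ _|k _]; [exact: measure_ge0|exact: muE].
  have /cvg_lim := @cvg_geometric_eseries_half R 2 0.
  move=> /(_ (@ereal_hausdorff _)) H.
  rewrite [X in (X < _)%E](_ : _ = (2 / 2 ^+ 0)%:E) ?ltry//.
  rewrite -H; apply: congr_lim; apply/funext => n /=.
  apply: eq_bigr => k _; congr EFin.
  by rewrite addn1 expnS natrM invfM mulrA divff// mul1r natrX exprVn.
exists (lim_sup_set E); split => //.
  apply: bigcap_measurable => // n _.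
  by apply: bigcup_measurable => k _; exact: mE.
move=> x /= nx n _; apply: contrapT => nE; apply: nx.
exists n => // k /= nk; rewrite leNgt; apply/negP => hk.
by apply: nE; exists k.
Qed.

Context (G : groupType) (T : G -> X -> X) (T_mp : mp_action mu T)
  (T_ergodic : ergodic mu T) (e : nat -> G) (e_surj : forall g, exists n, e n = g).

Let mT g : measurable_fun [set: X] (T g). Proof. by case: T_mp. Qed.

(** Ergodicity only speaks of strictly invariant sets. The union [W] of all
    translates of [V] is strictly invariant, measurable because the group is
    countable, and differs from [V] by a null set. *)
Lemma ae_invariant_01 (V : set X) : measurable V ->
  (forall g, \forall x \ae mu, V (T g x) <-> V x) ->
  (\forall x \ae mu, V x) \/ (\forall x \ae mu, ~ V x).
Proof.
move=> mV Vinv; pose W := \bigcup_n (T (e n) @^-1` V).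
have mW : measurable W.
  by apply: bigcupT_measurable => n; rewrite -[X in measurable X]setTI; exact: mT.
have Winv g : T g @^-1` W = W.
  apply/seteqP; split=> x [n _ /=] Vx.
    have [m em] := e_surj (e n * g)%g; exists m => //=.
    by rewrite em -(mp_actionM T_mp).
  have [m em] := e_surj (e n * g^-1)%g; exists m => //=.
  by rewrite em (mp_actionM T_mp) mulgVK.
have WV : \forall x \ae mu, W x -> V x.
  have : \forall x \ae mu, forall n, V (T (e n) x) <-> V x by exact: ae_foralln.
  by apply: filterS => x H [n _ /= /H].
have VW x : V x -> W x.
  move=> Vx; have [n en] := e_surj 1%g; exists n => //=.
  by rewrite en (mp_action1 T_mp).
have [W0|W1] := T_ergodic mW Winv; [right|left].
  have : \forall x \ae mu, ~ W x.
    exists W; split => // x /=; exact: contrapT.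
  by apply: filterS => x nW /VW.
have : \forall x \ae mu, W x.
  exists (~` W); split => //; first exact: measurableC.
  by rewrite probability_setC// W1 subee.
by apply: filterS2 WV => x WV /WV.
Qed.

(** The estimate on successive terms makes [f] converge almost everywhere, the
    other one makes the limit [l] almost everywhere invariant, and dominated convergence gives
    it the integral [c]. By ergodicity [c < l] holds almost everywhere or almost
    nowhere; in both cases [l - c] has constant sign and integral zero. *)
Lemma almost_invariant_ae_cvg (f : nat -> X -> R) (M c : R) :
  (forall k, measurable_fun [set: X] (f k)) ->
  (forall k x, `|f k x| <= M) -> (forall k, \int[mu]_x f k x = c) ->
  (forall k, \int[mu]_x ((f k.+1 x - f k x) ^+ 2) <= 8^-1 ^+ k) ->
  (forall k g, \int[mu]_x ((f k (T g x) - f k x) ^+ 2) <= 8^-1 ^+ k) ->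
  \forall x \ae mu, f k x @[k --> \oo] --> c.
Proof.
move=> mf fM If fcauchy finv.
have bf k : bdmeas (f k) by split=> //; exists M.
(* the upper limit is used because it is measurable and defined everywhere *)
pose l x := limn_sup (f ^~ x).
have ml : measurable_fun [set: X] l.
  apply: measurable_fun_limn_sup => // x _.
    by exists M => _ [k _ <-]; have := fM k x; rewrite ler_norml => /andP[].
  by exists (- M) => _ [k _ <-]; have := fM k x; rewrite ler_norml => /andP[].
have fl : \forall x \ae mu, f k x @[k --> \oo] --> l x.
  have := ae_fast_small (fun k => bdmeasB (bf k.+1) (bf k)) fcauchy.
  by apply: filterS => x /fast_cvgn fx; rewrite /l cvg_limn_supE.
have linv g : \forall x \ae mu, l (T g x) = l x.
  have bT k : bdmeas (f k \o T g) by exact: bdmeas_comp.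
  have := ae_fast_small (fun k => bdmeasB (bT k) (bf k)) (finv^~ g).
  apply: filterS2 fl => x fx /= small.
  have fd : (f k (T g x) - f k x) @[k --> \oo] --> (0 : R).
    apply/norm_cvg0P.
    apply: (@squeeze_cvgr _ _ _ _ (fun=> 0) (fun k => 2^-1 ^+ k)).
    - by apply: filterS small => k ->; rewrite normr_ge0.
    - exact: cvg_cst.
    - by apply: cvg_expr; rewrite ger0_norm//; lra.
  have : (f k (T g x) - f k x + f k x) @[k --> \oo] --> l x.
    by rewrite -[l x]add0r; exact: cvgD fd fx.
  under eq_cvg do rewrite subrK.
  by move=> /cvg_limn_inf_sup[_].
have fl' : \forall x \ae mu, [set: X] x -> (f k x)%:E @[k --> \oo] --> (l x)%:E.
  by apply: filterS fl => x fx _; apply: cvg_EFin => //; exact: nearW.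
have ci (a : R) : mu.-integrable [set: X] (EFin \o cst a).
  exact/bdmeas_integrable/bdmeas_cst.
have [li _ Il] := dominated_convergence measurableT
  (fun n => (measurable_EFinP _ _).2 (mf n)) ((measurable_EFinP _ _).2 ml)
  fl' (ci M)
  (aeW mu (fun x n _ => fM n x)).
have {}Il : \int[mu]_x l x = c.
  rewrite /Rintegral -(cvg_lim _ Il)//.
  rewrite (_ : [sequence _]_n = cst c%:E); first by rewrite lim_cst.
  by apply/funext => n /=; rewrite integral_bdmeas// If.
have lc : \forall x \ae mu, l x = c.
  have mV : measurable [set x | c < l x].
    have := measurable_fun_ltr (measurable_cst c) ml.
    by move=> /(_ measurableT [set true]); rewrite setTI; apply.
  have Vinv g : \forall x \ae mu, [set x | c < l x] (T g x) <-> [set x | c < l x] x.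
    by apply: filterS (linv g) => x /= ->.
  have [lec|lec] := ae_invariant_01 mV Vinv.
    have := @expect_ae_eq0 _ _ _ mu (fun x => l x - c).
    rewrite RintegralB//; last exact: ci.
    rewrite Il (expect_cst mu c) subrr => H.
    apply: filterS (H _ _ erefl) => [x /subr0_eq//||].
      exact: (integrableB measurableT li (ci c)).
    by apply: filterS lec => x /= /ltW; rewrite subr_ge0.
  have := @expect_ae_eq0 _ _ _ mu (fun x => c - l x).
  rewrite RintegralB//; last exact: ci.
  rewrite Il (expect_cst mu c) subrr => H.
  apply: filterS (H _ _ erefl) => [x /subr0_eq//||].
    exact: (integrableB measurableT (ci c) li).
  by apply: filterS lec => x /= /negP; rewrite -leNgt subr_ge0.
by apply: filterS2 fl lc => x + <-.
Qed.

End FastConvergence.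

(** * Generic points along a subsequence *)

(** The k-th index is the sum of the first k + 1 thresholds, each increased by one
    to make the sequence strictly increasing. *)
Lemma diagonal_subseq (P : nat -> nat -> Prop) :
  (forall k, \forall N \near \oo, P k N) ->
  exists n : nat -> nat, increasing_seq n /\ forall k, P k (n k).
Proof.
move=> HP.
have /choice[m Hm] : forall k, exists m, forall N, (m <= N)%N -> P k N.
  by move=> k; have [m _ Hm] := HP k; exists m => N; exact: Hm.
exists (fun k => \sum_(i < k.+1) (m i).+1)%N; split.
  apply/increasing_seqP => k; rewrite [X in (_ < X)%O]big_ord_recr /= ltEnat /=.
  by rewrite addnS ltnS leq_addr.
by move=> k; apply: Hm; rewrite big_ord_recr /= addnS ltnW// ltnS leq_addl.
Qed.

Lemma near_forall_lt (P : nat -> nat -> Prop) (k : nat) :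
  (forall i, \forall N \near \oo, P i N) ->
  \forall N \near \oo, forall i, (i < k)%N -> P i N.
Proof.
move=> HP; elim: k => [|k IHk]; first exact: nearW.
apply: filterS2 IHk (HP k) => N IH PkN i.
by rewrite ltnS leq_eqVlt => /predU1P[->|/IH].
Qed.

Lemma countable_enum (G : groupType) : countable [set: G] ->
  exists e : nat -> G, forall g, exists n, e n = g.
Proof.
move=> /pfcard_geP[/seteqP[/(_ 1%g Logic.I)]//|[e]]; exists e => g.
by have [n _ <-] := @surj _ _ _ _ e g Logic.I; exists n.
Qed.

Lemma densityE (R : realType) (G : groupType) (X : Type) (T : G -> X -> X)
    (S : {fset G}) (B : set X) (x : X) :
  #|` [fset h in S | h \in [set h | B (T h x)]]%fset |%:R / #|` S|%:R =
  avg T S (\1_B : X -> R) x.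
Proof.
rewrite /avg; congr (_ / _).
rewrite card_fset_sum1 natr_sum big_fset/= big_mkcond/=; apply: eq_bigr => h _.
rewrite indicE (_ : (T h x \in B) = (h \in [set h | B (T h x)])); first by case: ifP.
by apply/idP/idP; rewrite !inE.
Qed.

(** The intersection of the preimages of [A] under [T g], for [g] in a list: lists
    over a countable type are countable, which makes room for all tuples at once. *)
Definition joint_return (G : Type) (X : Type) (T : G -> X -> X) (A : set X)
  (s : seq G) : set X := foldr (fun g B => T g @^-1` A `&` B) setT s.

Lemma joint_return_codom (G : eqType) (X : Type) (T : G -> X -> X) (A : set X) r
    (g : 'I_r -> G) :
  joint_return T A (map g (enum 'I_r)) = \bigcap_(i in [set: 'I_r]) (T (g i) @^-1` A).
Proof.
have joint_returnE s x : joint_return T A (map g s) x <->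
    forall i, i \in s -> A (T (g i) x).
  elim: s => [|a s IHs] /=; first by split.
  split=> [[Aa /IHs As] i|H].
    by rewrite inE => /predU1P[->|/As].
  split; first by apply: H; rewrite mem_head.
  by apply/IHs => i si; apply: H; rewrite inE si orbT.
apply/seteqP; split=> x; first by move=> /joint_returnE H i _; apply: H; rewrite mem_enum.
by move=> H; apply/joint_returnE => i _; exact: H.
Qed.

Section Genericity.
Context (R : realType) (G : groupType) (d : measure_display)
  (X : measurableType d) (mu : probability X R) (T : G -> X -> X)
  (T_mp : mp_action mu T) (T_ergodic : ergodic mu T)
  (F : nat -> {fset G}) (F_Folner : left_Folner R F)
  (e : nat -> G) (e_surj : forall g, exists n, e n = g).

(** The k-th index of the subsequence is chosen so late that the averages of the
    first [k + 1] sets have reached the precision [8^-k]. For a fixed [i] the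
    estimates hold from the index [i] on, whence the shifted sequence [f]. *)
Lemma generic_subseq (B : nat -> set X) : (forall i, measurable (B i)) ->
  exists n : nat -> nat, increasing_seq n /\
    \forall x \ae mu, forall i,
      avg T (F (n k)) (\1_(B i)) x @[k --> \oo] --> fine (mu (B i)).
Proof.
move=> mB.
have bB i : bdmeas (\1_(B i) : X -> R) by exact: bdmeas_indic.
have e0 k : 0 < (8^-1 : R) ^+ k by rewrite exprn_gt0.
have := diagonal_subseq (fun k => near_forall_lt k.+1
  (fun i => mean_ergodic_cauchy T_mp F_Folner (bB i) (e0 k))).
move=> [n [n_incr Hn]]; exists n; split=> //; apply: ae_foralln => i.
pose f k := avg T (F (n (k + i)%N)) (\1_(B i) : X -> R).
have small k : (8^-1 : R) ^+ (k + i) <= 8^-1 ^+ k.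
  by rewrite exprD ler_piMr ?exprn_ge0// exprn_ile1//; lra.
have F0 N : F N != fset0 by case: F_Folner.
have : \forall x \ae mu, f k x @[k --> \oo] --> fine (mu (B i)).
  apply: (almost_invariant_ae_cvg T_mp T_ergodic e_surj (M := 1)).
  - by move=> k; case: (bdmeas_avg T_mp (F (n (k + i)%N)) (bB i)).
  - move=> k x; apply: norm_avg_le => // y.
    by rewrite indicE; case: (_ \in _); rewrite ?normr1 ?normr0.
  - by move=> k; rewrite (expect_avg T_mp)// expect_indic.
  - move=> k; apply: le_trans (small k).
    have [+ _] := Hn (k + i)%N i (leq_addl _ _).
    move=> H; apply: H.
    by have := n_incr (k + i)%N (k.+1 + i)%N; rewrite leEnat => ->; rewrite leq_add2r.
  - move=> k g; apply: le_trans (small k).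
    by have [_ /(_ g)] := Hn (k + i)%N i (leq_addl _ _).
by apply: filterS => x fx; rewrite -(cvg_shiftn i).
Qed.

End Genericity.

Theorem theorem5p1 (R : realType) (G : groupType)
    (G_countable : countable [set: G]) (G_amenable : amenable R G)
    (d : measure_display) (X : measurableType d) (mu : probability X R)
    (T : G -> X -> X) (T_mp : mp_action mu T) (T_ergodic : ergodic mu T)
    (A : set X) (A_measurable : measurable A) (A_pos : (0 < mu A)%E)
    (F : nat -> {fset G}) (F_Folner : left_Folner R F) :
  exists (n : nat -> nat) (E : set G),
    [/\ increasing_seq n,
        (forall (r : nat) (g : 'I_r -> G), (0 < r)%N ->
          has_density (F \o n)
            (\bigcap_(i in [set: 'I_r]) inv_translate (g i) E)
            (fine (mu (\bigcap_(i in [set: 'I_r]) (T (g i) @^-1` A))))) &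
        has_density (F \o n) E (fine (mu A))].
Proof.
have [e e_surj] := countable_enum G_countable.
pose code i : seq G := map e (odflt [::] (choice.unpickle i)).
have code_surj s : exists i, code i = s.
  have /choice[e' e'K] := e_surj.
  exists (choice.pickle (map e' s)); rewrite /code choice.pickleK /= -map_comp.
  by rewrite (eq_map (g := id)) ?map_id// => g /=.
have mB s : measurable (joint_return T A s).
  elim: s => [|g s IHs] /=; first exact: measurableT.
  apply: measurableI => //; rewrite -[X in measurable X]setTI.
  exact: (mp_measurable T_mp).
have [n [n_incr Hn]] := generic_subseq T_mp T_ergodic F_Folner e_surj
  (fun i => mB (code i)).
have [x Hx] : exists x, forall i,
    avg T (F (n k)) (\1_(joint_return T A (code i))) x @[k --> \oo] -->
      fine (mu (joint_return T A (code i))).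
  have mu0 : (0 < mu [set: X])%E by rewrite [X in (_ < X)%E](probability_setT mu).
  exact: (@filter_ex _ _ (ae_properfilter_algebraOfSetsType mu0) _ Hn).
have dens s : has_density (F \o n) [set h | joint_return T A s (T h x)]
    (fine (mu (joint_return T A s))).
  have [i <-] := code_surj s; rewrite /has_density /=.
  by under eq_cvg do rewrite densityE; exact: Hx.
exists n, [set g | A (T g x)]; split => //.
- move=> r g _; have := dens (map g (enum 'I_r)); rewrite joint_return_codom.
  congr has_density; apply/seteqP; split=> h /= H i _ /=.
    by rewrite /inv_translate /= -(mp_actionM T_mp); exact: H.
  by have := H i Logic.I; rewrite /inv_translate /= -(mp_actionM T_mp).
- have := dens [:: 1%g]; rewrite /joint_return /= setIT.
  have T1 : T 1%g = id by apply/funext => y; exact: (mp_action1 T_mp).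
  rewrite T1 (_ : [set h | _ /\ True] = [set g | A (T g x)])//.
  by apply/seteqP; split=> h /= => [[]|].
Qed.
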